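(* Let $S\subset\mathbb{Z}_+$ be a proper cofinite set, and let $n,\beta,m$ be positive integers with $\lfloor n/m\rfloor>2\beta$ and $\Lambda_n^\beta\neq\emptyset$. Let $Q_n$ be the uniform probability measure on $\Lambda_n^\beta$. Then for every value $\vec W$ of the decomposition vector with $\Lambda_{\vec W}\ne\emptyset$ and all real $y_1,\dots,y_{m+1}$, $$Q_n\left(\mathbf{L}_i=y_i\ \text{for all } 1\le i\le m+1\ \middle|\ \vec W\right)=\prod_{i=1}^{m+1}Q_n\left(\mathbf{L}_i=y_i\ \middle|\ \vec W\right),$$ where conditioning on $\vec W$ means conditioning on the event $\Lambda_{\vec W}$.
   Context: ''Proper cofinite'' means $\mathbb{Z}_+\setminus S$ is finite and nonempty. An $S$-restricted composition of $n$ is a finite sequence of elements of $S$ summing to $n$. $\Lambda_n^\beta$ is the set of $S$-restricted compositions of $n$ all of whose parts are at most $\beta$. Decomposition: for $\vec\lambda=(\lambda_1,\dots,\lambda_\tau)\in\Lambda_n^\beta$ ($\tau$ = number of parts) and $i=1,\dots,m$ let $\tau_i=\min\{t:\lambda_1+\dots+\lambda_t\ge i\lfloor n/m\rfloor\}$, and $\tau_0=0$. Define the (possibly empty) sequences $\Pi_0=(\lambda_{\tau_1},\dots,\lambda_{\tau_m})$, $\Pi_i=(\lambda_{\tau_{i-1}+1},\dots,\lambda_{\tau_i-1})$ for $1\le i\le m$, and $\Pi_{m+1}=(\lambda_{\tau_m+1},\dots,\lambda_\tau)$. For a finite sequence $\Pi$ of positive integers, $|\Pi|$ is the sum of its entries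 and $\mathbf{B}(\Pi)$ the product of its entries ($\mathbf{B}$ of the empty sequence is $1$). For $1\le i\le m+1$ let $\pi_i=|\Pi_i|$, let $p_i=1+\lambda_1+\dots+\lambda_{\tau_{i-1}}$ (the position of the first unit belonging to $\Pi_i$ when $\vec\lambda$ is viewed as a row of $n$ units), $W_i=(\pi_i,p_i)$ and $\vec W(\vec\lambda)=(W_1,\dots,W_{m+1})$. For a value $\vec W$, $\Lambda_{\vec W}=\{\vec\lambda\in\Lambda_n^\beta:\vec W(\vec\lambda)=\vec W\}$. Finally $\mathbf{L}_i(\vec\lambda)=\log\mathbf{B}(\Pi_i(\vec\lambda))$. *)

(* Defs.v *)
From HB Require Import structures.
From mathcomp Require Export all_boot all_order all_algebra.
From mathcomp Require Export finmap boolp classical_sets functions cardinality.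
From mathcomp Require Export reals exp.

Set Implicit Arguments.
Unset Strict Implicit.
Unset Printing Implicit Defensive.

Import Order.TTheory GRing.Theory Num.Theory.

Local Open Scope classical_set_scope.
Local Open Scope ring_scope.

Definition posnat : set nat := [set k | (0 < k)%N].

Definition proper_cofinite (S : set nat) : Prop :=
  [/\ S `<=` posnat, finite_set (posnat `\` S) & posnat `\` S !=set0].

Definition is_composition (S : set nat) (n : nat) (s : seq nat) : Prop :=
  (forall k, k \in s -> S k) /\ sumn s = n.

Definition Lambda (S : set nat) (n beta : nat) : set (seq nat) :=
  [set s | is_composition S n s /\ forall k, k \in s -> (k <= beta)%N].

(* [find] returns the least t in {0, ..., size s} such that
   lambda_1 + ... + lambda_t >= i * floor(n / m); one exists when sumn s = n
   and i <= m. *)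
Definition tau (n m : nat) (s : seq nat) (i : nat) : nat :=
  if i is 0%N then 0%N
  else find (fun t => (i * (n %/ m) <= sumn (take t s))%N) (iota 0 (size s).+1).

(* Pi_i for 1 <= i <= m + 1; entries of s are numbered from 0, so lambda_t is
   [nth 0 s t.-1].  Pi_0 plays no role in the decomposition vector or in the
   L_i with i >= 1. *)
Definition block (n m : nat) (s : seq nat) (i : nat) : seq nat :=
  if (i <= m)%N
  then drop (tau n m s i.-1) (take (tau n m s i).-1 s)
  else drop (tau n m s m) s.

Definition block_sum (n m : nat) (s : seq nat) (i : nat) : nat :=
  sumn (block n m s i).

Definition block_pos (n m : nat) (s : seq nat) (i : nat) : nat :=
  (1 + sumn (take (tau n m s i.-1) s))%N.

(* The component with 0-based index i is W_(i + 1). *)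
Definition Wvec (n m : nat) (s : seq nat) : m.+1.-tuple (nat * nat) :=
  [tuple (block_sum n m s i.+1, block_pos n m s i.+1) | i < m.+1].

Definition LambdaW (S : set nat) (n beta m : nat)
    (W : m.+1.-tuple (nat * nat)) : set (seq nat) :=
  [set s | Lambda S n beta s /\ Wvec n m s = W].

Definition Bprod (s : seq nat) : nat := (\prod_(k <- s) k)%N.

Definition Llog (R : realType) (n m : nat) (s : seq nat) (i : nat) : R :=
  ln ((Bprod (block n m s i))%:R).

(* Meaningful for finite nonempty A ([fset_set] is empty on infinite sets);
   see [finite_Lambda]. *)
Definition uniform_pr (R : realType) (T : choiceType) (A E : set T) : R :=
  #|` fset_set (A `&` E)|%:R / #|` fset_set A|%:R.

Definition cond_pr (R : realType) (T : Type) (P : set T -> R)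
    (E F : set T) : R := P (E `&` F) / P F.

Definition Qn (R : realType) (S : set nat) (n beta : nat) :
  set (seq nat) -> R := @uniform_pr R _ (Lambda S n beta).

Lemma finite_Lambda (S : set nat) (n beta : nat) :
  S `<=` posnat -> finite_set (Lambda S n beta).
Proof.
move=> Spos.
pose f (t : {bseq n of 'I_n.+1}) : seq nat := [seq val x | x <- bseqval t].
apply: (@sub_finite_set _ _ (range f)); last first.
  by apply: finite_image; exact: finite_finset.
move=> s [[sS sn] _].
have szle (r : seq nat) : (forall k, k \in r -> (0 < k)%N) ->
    (size r <= sumn r)%N.
  elim: r => //= a r IH h; rewrite -add1n leq_add //.
    by apply: h; rewrite mem_head.
  by apply: IH => k kr; apply: h; rewrite in_cons kr orbT.
have lesum (r : seq nat) k : k \in r -> (k <= sumn r)%N.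
  elim: r => //= a r IH; rewrite in_cons => /orP[/eqP ->|/IH h].
    exact: leq_addr.
  exact: leq_trans h (leq_addl _ _).
have szs : (size [seq (inord x : 'I_n.+1) | x <- s] <= n)%N.
  by rewrite size_map -sn; apply: szle => k /sS /Spos.
exists (Bseq szs) => //; rewrite /f /= -map_comp.
rewrite -[RHS]map_id; apply/eq_in_map => k ks /=.
by rewrite inordK // ltnS -sn; exact: lesum.
Qed.

(* Main.v *)
Require Import Defs.
From mathcomp Require Import all_boot all_order all_algebra.
From mathcomp Require Import boolp classical_sets functions cardinality.
From mathcomp Require Import reals exp.
From mathcomp Require Import finmap zify.

Set Implicit Arguments.
Unset Strict Implicit.
Unset Printing Implicit Defensive.

Import Order.TTheory GRing.Theory Num.Theory.

Local Open Scope classical_set_scope.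
Local Open Scope ring_scope.

(** On [LambdaW] the blocks [Pi_1, ..., Pi_(m+1)] determine the composition,
    because the separating part [lambda_(tau_i)] equals
    [p_(i+1) - p_i - pi_i].  Moreover the image of [LambdaW] under the block map
    is a full product: two compositions with the same [W] can be cut right
    after their [tau_j]-th parts, where their partial sums agree, and recombined
    without changing [W].  A uniform variable on a finite set that its
    coordinates identify with a product has independent coordinates. *)

Lemma leq_sumn_take (s : seq nat) (t u : nat) :
  (t <= u)%N -> (sumn (take t s) <= sumn (take u s))%N.
Proof.
by move=> tu; rewrite -(subnKC tu) takeD sumn_cat leq_addr.
Qed.

(** * Independence of the coordinates under a uniform measure *)

(** The first hypothesis makes [t |-> (f i t)_i] injective, the second makes its image the full
    product of the [codom (f i)]; a coordinatewise condition then cuts out a product of subsets. *)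
Lemma card_rectangle (k : nat) (T U : finType) (f : 'I_k -> T -> U)
    (P : 'I_k -> pred U) :
  (forall s t, (forall i, f i s = f i t) -> s = t) ->
  (forall g : 'I_k -> T, exists t, forall i, f i t = f i (g i)) ->
  #|[set t | [forall i, P i (f i t)]]%SET|
  = (\prod_(i < k) #|[set x in codom (f i) | P i x]%SET|)%N.
Proof.
move=> finj frect.
pose F t := [ffun i => f i t].
have Finj : injective F.
  move=> s t /ffunP e; apply: finj => i.
  by have := e i; rewrite !ffunE.
rewrite -(card_imset _ Finj).
pose G (i : 'I_k) := [pred x in codom (f i) | P i x].
have -> : [set F x | x in [set t | [forall i, P i (f i t)]]]%SET
          = [set h in family G]%SET.
  apply/setP => h; rewrite inE; apply/imsetP/familyP => [[t]|hG].
    rewrite inE => /forallP Pt -> i.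
    by rewrite ffunE inE codom_f Pt.
  have hc i : h i \in codom (f i) by have := hG i; rewrite inE => /andP[].
  (* Each [h i] has some preimage under [f i]; [frect] merges these preimages into a single
     point. *)
  have [t tE] := frect (fun i => iinv (hc i)).
  have hE i : f i t = h i by rewrite tE f_iinv.
  exists t; last by apply/ffunP => i; rewrite ffunE hE.
  by rewrite inE; apply/forallP => i; have := hG i; rewrite inE hE => /andP[].
rewrite cardsE card_family foldrE big_map big_enum.
by apply: eq_bigr => i _; rewrite cardsE.
Qed.

(** Three uses of [card_rectangle] suffice: with no constraint (the size of [T]), with a constraint
    on one coordinate (the marginals), and with all constraints (the joint event). *)
Lemma uniform_independent_fin (R : realFieldType) (k : nat) (T U : finType)
    (f : 'I_k -> T -> U) (P : 'I_k -> pred U) :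
  (0 < #|T|)%N ->
  (forall s t, (forall i, f i s = f i t) -> s = t) ->
  (forall g : 'I_k -> T, exists t, forall i, f i t = f i (g i)) ->
  #|[set t | [forall i, P i (f i t)]]%SET|%:R / #|T|%:R
  = \prod_(i < k) (#|[set t | P i (f i t)]%SET|%:R / #|T|%:R) :> R.
Proof.
move=> T0 finj frect.
pose X i := #|[set x in codom (f i)]%SET|.
have X0 i : (X i)%:R != 0 :> R.
  rewrite pnatr_eq0 -lt0n; apply/card_gt0P.
  by case/card_gt0P: T0 => t _; exists (f i t); rewrite inE codom_f.
have TE : #|T| = (\prod_(i < k) X i)%N.
  rewrite -[LHS]cardsT; have := card_rectangle (fun=> predT) finj frect.
  have -> : [set t | [forall i : 'I_k, predT (f i t)]]%SET = [set: T]%SET.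
    by apply/setP => t; rewrite !inE; apply/forallP.
  by move=> ->; apply: eq_bigr => i _; apply: eq_card => x; rewrite !inE andbT.
have marg i : #|[set t | P i (f i t)]%SET|%:R / #|T|%:R
    = #|[set x in codom (f i) | P i x]%SET|%:R / (X i)%:R :> R.
  (* Only coordinate [i] is constrained, so every factor [X j] with [j != i] cancels against
     [#|T|]. *)
  have := card_rectangle (fun j x => (j == i) ==> P j x) finj frect.
  have -> : [set t | [forall j, (j == i) ==> P j (f j t)]]%SET
            = [set t | P i (f i t)]%SET.
    apply/setP => t; rewrite !inE; apply/forallP/idP => [/(_ i)|Pi j].
      by rewrite eqxx.
    by apply/implyP => /eqP ->.
  rewrite (bigD1 i) //= eqxx => ->.
  have -> : #|T| = (X i * \prod_(j < k | j != i) X j)%N.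
    by rewrite TE (bigD1 i).
  rewrite [X in (_ * X)%N](_ : _ = (\prod_(j < k | j != i) X j)%N); last first.
    apply: eq_bigr => j /negbTE ->.
    by apply: eq_card => x; rewrite !inE andbT.
  rewrite !natrM -mulf_div divff ?mulr1 // natr_prod.
  by apply/prodf_neq0 => j _; exact: X0.
under eq_bigr do rewrite marg.
by rewrite prodf_div -!natr_prod (card_rectangle P finj frect) TE.
Qed.

Lemma uniform_independent (R : realType) (k : nat) (T U : choiceType)
    (A : set T) (f : 'I_k -> T -> U) (P : 'I_k -> set U) :
  finite_set A -> A !=set0 ->
  (forall s t, A s -> A t -> (forall i, f i s = f i t) -> s = t) ->
  (forall g : 'I_k -> T, (forall i, A (g i)) ->
    exists2 t, A t & forall i, f i t = f i (g i)) ->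
  uniform_pr R A [set t | forall i, P i (f i t)]
  = \prod_(i < k) uniform_pr R A [set t | P i (f i t)].
Proof.
move=> Afin [a Aa] finj frect.
pose X := fset_set A.
have inX t : (t \in X) = (t \in A) by rewrite in_fset_set.
(* [U] may be infinite; the finite set of attained values serves as codomain. *)
pose Y := [fset f i t | i in 'I_k, t in X]%fset.
have fY i (t : X) : f i (val t) \in Y.
  by apply/imfset2P; exists i => //; exists (val t) => //; exact: valP.
pose h i (t : X) : Y := [` fY i t]%fset.
have cardE (E : set T) :
    #|` fset_set (A `&` E)| = #|[set t : X | `[< E (val t) >]]%SET|.
  have AEf : finite_set (A `&` E) by exact: finite_setIl.
  rewrite cardE -(size_map val).
  apply/perm_size/uniq_perm; first exact: fset_uniq.
    by rewrite map_inj_uniq ?enum_uniq //; exact: val_inj.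
  move=> t; rewrite in_fset_set //; apply/idP/mapP => [/set_mem[At Et]|[x]].
    have tX : t \in X by rewrite inX; exact: mem_set.
    by exists [` tX]%fset => //; rewrite mem_enum inE; apply/asboolP.
  rewrite mem_enum inE => /asboolP Ex ->; apply: mem_set; split => //.
  by have := valP x; rewrite inX => /set_mem.
have XE : #|` X| = #|X : finType| by rewrite cardfE.
rewrite /uniform_pr -/X XE.
under eq_bigr do rewrite cardE.
rewrite cardE.
have := @uniform_independent_fin R k X Y h (fun i x => `[< P i (val x) >]).
move=> <-.
- congr (_%:R / _); apply: eq_card => t; rewrite !inE.
  apply/asboolP/forallP => [Pt i|Pt i]; first exact/asboolP.
  by have /asboolP := Pt i.
- apply/card_gt0P; have aX : a \in X by rewrite inX; exact: mem_set.
  by exists [` aX]%fset.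
- move=> s t st; apply: val_inj; apply: finj => [||i].
  + by apply: set_mem; rewrite -inX; exact: valP.
  + by apply: set_mem; rewrite -inX; exact: valP.
  + by have /(congr1 val) := st i.
- move=> g; have [i|t At tE] := frect (fun i => val (g i)).
    by apply: set_mem; rewrite -inX; exact: valP.
  have tX : t \in X by rewrite inX; exact: mem_set.
  by exists [` tX]%fset => i; apply: val_inj; exact: tE.
Qed.

(** * The cutting indices [tau] *)

Section Tau.
Variables (S : set nat) (n beta m : nat).
Hypothesis hnm : (2 * beta < n %/ m)%N.

Local Notation tau := (tau n m).
Local Notation q := (n %/ m)%N.

(** Partial sums are monotone, and the search succeeds because [i * q <= m * q <= n]. This
    equivalence replaces [find] in everything that follows. *)
Lemma tau_leE (s : seq nat) (i t : nat) : sumn s = n -> (i <= m)%N ->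
  (tau s i <= t)%N = (i * q <= sumn (take t s))%N.
Proof.
move=> sn im; case: i im => [|i] im; first by rewrite mul0n !leq0n.
rewrite /Defs.tau; set p := (fun t => _).
have hp : has p (iota 0 (size s).+1).
  apply/hasP; exists (size s); first by rewrite mem_iota /= ltnS.
  rewrite /p take_size sn (leq_trans _ (leq_trunc_div n m)) //.
  by rewrite mulnC leq_mul2l im orbT.
have fs : (find p (iota 0 (size s).+1) < (size s).+1)%N.
  by rewrite -[X in (_ < X)%N](size_iota 0) -has_find.
apply/idP/idP => [ft|pt]; last first.
  rewrite leqNgt; apply/negP => lt.
  have := before_find 0%N lt; rewrite nth_iota ?add0n; last exact: ltn_trans fs.
  by rewrite /p pt.
have := nth_find 0%N hp; rewrite nth_iota // add0n /p => /leq_trans; apply.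
exact: leq_sumn_take.
Qed.

Lemma tau_unique (s : seq nat) (i x : nat) : sumn s = n -> (i <= m)%N ->
  (forall t, (x <= t)%N = (i * q <= sumn (take t s))%N) -> tau s i = x.
Proof.
move=> sn im h; apply/eqP; rewrite eqn_leq tau_leE // -h leqnn /=.
by rewrite h -tau_leE.
Qed.

Lemma leq_tau (s : seq nat) (i j : nat) : sumn s = n -> (i <= j <= m)%N ->
  (tau s i <= tau s j)%N.
Proof.
move=> sn /andP[ij jm]; rewrite tau_leE // ?(leq_trans ij) //.
apply: (@leq_trans (j * q)); first by rewrite leq_mul2r ij orbT.
by rewrite -tau_leE.
Qed.

(** Before the part at [tau s i] the partial sum is below [i * q]; that part adds at most
    [beta < q], so the threshold [i.+1 * q] is not yet reached. Hence distinct cuts have distinct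
    separating parts. *)
Lemma ltn_tauS (s : seq nat) (i : nat) : Lambda S n beta s -> (i < m)%N ->
  (tau s i < tau s i.+1)%N.
Proof.
move=> [[_ sn] sb] im; rewrite ltnNge tau_leE //.
case ti : (tau s i) => [|t]; first by rewrite take0 /=; nia.
have : ~~ (i * q <= sumn (take t s))%N by rewrite -tau_leE ?ti ?ltnn ?(ltnW im).
have [ts|ts] := ltnP t (size s).
  rewrite (take_nth 0%N ts) -cats1 sumn_cat /= addn0.
  have := sb _ (mem_nth 0%N ts).
  rewrite mulSn; move: hnm.
  by move: (nth _ _ _) (sumn _) (i * q)%N => c u v; lia.
have -> : take t.+1 s = take t s by rewrite !take_oversize ?(leqW ts).
by rewrite mulSn; move: hnm; move: (i * q)%N => x; lia.
Qed.

Lemma ltn_tau (s : seq nat) (i j : nat) : Lambda S n beta s ->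
  (i < j <= m)%N -> (tau s i < tau s j)%N.
Proof.
move=> Ls /andP[ij jm].
apply: leq_trans (ltn_tauS Ls (leq_trans ij jm)) _.
by apply: leq_tau; [case: Ls => -[] | rewrite ij].
Qed.

Lemma tau_size (s : seq nat) (i : nat) : sumn s = n -> (i <= m)%N ->
  (tau s i <= size s)%N.
Proof.
move=> sn im; rewrite tau_leE // take_size sn.
apply: leq_trans (leq_trunc_div n m).
by rewrite mulnC leq_mul2l im orbT.
Qed.

Arguments Defs.tau : simpl never.

(** * Compositions with equal [W]: reconstruction and gluing *)

Lemma Wvec_eqP (s s' : seq nat) :
  Wvec n m s = Wvec n m s' <->
  (forall i, (i <= m)%N -> block_sum n m s i.+1 = block_sum n m s' i.+1 /\
                           sumn (take (tau s i) s) = sumn (take (tau s' i) s')).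
Proof.
split=> [e i im|h].
  have := congr1 (fun t => tnth t (Ordinal (im : i < m.+1)%N)) e.
  by rewrite !tnth_mktuple /block_pos /= => -[e1 e2]; split.
apply: eq_from_tnth => i; rewrite !tnth_mktuple /block_pos /=.
by have [-> ->] := h i (ltn_ord i).
Qed.

Lemma LambdaW_blocks_inj (W : m.+1.-tuple (nat * nat)) (s s' : seq nat) :
  LambdaW S n beta W s -> LambdaW S n beta W s' ->
  (forall i, (i <= m)%N -> block n m s i.+1 = block n m s' i.+1) -> s = s'.
Proof.
move=> [Ls Ws] [Ls' Ws'] bE.
have /Wvec_eqP hW : Wvec n m s = Wvec n m s' by rewrite Ws Ws'.
(* A prefix up to a cut is the previous prefix, then a block, then one separating part [c]. *)
have take_tauS u i : Lambda S n beta u -> (i < m)%N -> exists c,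
    take (tau u i.+1) u = take (tau u i) u ++ rcons (block n m u i.+1) c.
  move=> Lu im; have lt := ltn_tauS Lu im; exists (nth 0%N u (tau u i.+1).-1).
  have sz : (tau u i.+1 <= size u)%N by apply: tau_size => //; case: Lu => -[].
  rewrite -rcons_cat /block im /=.
  have -> : take (tau u i) u = take (tau u i) (take (tau u i.+1).-1 u).
    by rewrite take_takel //; lia.
  rewrite cat_take_drop -take_nth; last lia.
  by rewrite prednK //; lia.
have pre i : (i <= m)%N -> take (tau s i) s = take (tau s' i) s'.
  elim: i => [|i IH] im; first by rewrite !take0.
  have [c cE] := take_tauS s i Ls im; have [c' cE'] := take_tauS s' i Ls' im.
  have [_] := hW i.+1 im; rewrite cE cE' IH ?(ltnW im) // bE ?(ltnW im) //.
  (* The prefixes have equal sums and differ at most in the separator, which is therefore forced. *)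
  by rewrite !sumn_cat !sumn_rcons => e; have -> : c = c' by lia.
have := bE m (leqnn m); rewrite /block ltnn => dE.
by rewrite -(cat_take_drop (tau s m) s) dE pre // cat_take_drop.
Qed.

(** The glued sequence has the partial sums of [s] up to the cut and, since the sums at the cut
    agree, those of [s'] after it with indices shifted by [a - a']. Its cuts and blocks are
    inherited accordingly. *)
Lemma LambdaW_crossover (W : m.+1.-tuple (nat * nat)) (s s' : seq nat)
    (j : nat) :
  LambdaW S n beta W s -> LambdaW S n beta W s' -> (j <= m)%N ->
  exists2 t, LambdaW S n beta W t & forall i, (i <= m)%N ->
    block n m t i.+1 = block n m (if (i < j)%N then s else s') i.+1.
Proof.
move=> [Ls Ws] [Ls' Ws'] jm.
have /Wvec_eqP hW : Wvec n m s = Wvec n m s' by rewrite Ws Ws'.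
have [[sS sn] sb] := Ls; have [[sS' sn'] sb'] := Ls'.
set a := tau s j; set a' := tau s' j.
have aE : sumn (take a s) = sumn (take a' s') by have [] := hW j jm.
have asz : size (take a s) = a by rewrite size_takel // tau_size.
pose t := take a s ++ drop a' s'.
have tS k : k \in t -> k \in s \/ k \in s'.
  by rewrite mem_cat => /orP[/mem_take|/mem_drop]; [left|right].
have tn : sumn t = n by rewrite sumn_cat aE -sumn_cat cat_take_drop.
have Lt : Lambda S n beta t.
  split; first split=> // k /tS[]; [exact: sS|exact: sS'|].
  by move=> k /tS[]; [exact: sb|exact: sb'].
have takel u : (u <= a)%N -> take u t = take u s.
  by move=> ua; rewrite takel_cat ?asz // take_takel.
have taker d : take (a + d) t = take a s ++ take d (drop a' s').
  by rewrite take_cat asz ltnNge leq_addr /= addKn.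
have sumr d : sumn (take (a + d) t) = sumn (take (a' + d) s').
  by rewrite taker sumn_cat aE takeD sumn_cat.
have taul i : (i <= j)%N -> tau t i = tau s i.
  move=> ij; have im := leq_trans ij jm.
  have ia : (tau s i <= a)%N by apply: leq_tau => //; rewrite ij.
  apply: tau_unique => // u; have [ua|au] := leqP u a.
    by rewrite takel // tau_leE.
  (* Beyond [a] both sides are true: the threshold was already reached inside the prefix taken from
     [s]. *)
  rewrite (leq_trans ia (ltnW au)); apply/esym.
  apply: leq_trans (leq_sumn_take t (ltnW au)).
  by rewrite takel // -tau_leE.
have taur i : (j <= i <= m)%N -> tau t i = (a + (tau s' i - a'))%N.
  rewrite leq_eqVlt => /andP[/orP[/eqP <-|ji] im].
    by rewrite subnn addn0 taul.
  (* Strictness matters: the sum at the cut is that of [s'] at [a'], still below [i * q], so no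
     index [u < a] reaches the threshold. *)
  have lt : (a' < tau s' i)%N by apply: ltn_tau => //; rewrite ji.
  apply: tau_unique => // u; have [au|ua] := leqP a u.
    by rewrite -(subnKC au) sumr -tau_leE //; lia.
  have -> : (a + (tau s' i - a') <= u)%N = false by lia.
  apply/esym/negbTE; rewrite -ltnNge.
  apply: leq_ltn_trans (leq_sumn_take t (ltnW ua)) _.
  by rewrite -[X in take X]addn0 sumr addn0 ltnNge -tau_leE // -ltnNge.
have bE i : (i <= m)%N ->
    block n m t i.+1 = block n m (if (i < j)%N then s else s') i.+1.
  move=> im; have [ij|ji] := ltnP i j.
    have le : ((tau s i.+1).-1 <= a)%N.
      by apply: leq_trans (leq_pred _) _; apply: leq_tau => //; rewrite ij.
    by rewrite /block (leq_trans ij jm) /= !taul ?(ltnW ij) // takel.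
  have ai : (a' <= tau s' i)%N by apply: leq_tau => //; rewrite ji.
  have dropr v d : drop (a + d) (take a s ++ v) = drop d v.
    by rewrite drop_cat asz ltnNge leq_addr /= addKn.
  (* An inner block stops just before its separator, whereas the last block runs to the end. *)
  rewrite /block /=; case: ltnP => im'.
    have lt := ltn_tauS Ls' im'.
    rewrite !taur ?ji ?(leq_trans ji) //=.
    have -> : (a + (tau s' i.+1 - a')).-1 = (a + ((tau s' i.+1).-1 - a'))%N.
      by lia.
    rewrite taker dropr take_drop drop_drop.
    by rewrite !subnK //; lia.
  have am : (a' <= tau s' m)%N by apply: leq_tau => //; rewrite jm leqnn.
  by rewrite taur ?jm ?leqnn // dropr drop_drop subnK.
exists t => //; split=> //.
rewrite -Ws; apply/Wvec_eqP => i im; split.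
  by rewrite /block_sum bE //; case: ifP => // _; have [] := hW i im.
have [ij|ji] := leqP i j.
  by rewrite taul // takel //; apply: leq_tau => //; rewrite ij.
have ai : (a' <= tau s' i)%N by apply: leq_tau => //; rewrite (ltnW ji).
by rewrite taur ?(ltnW ji) // sumr subnKC //; have [] := hW i im.
Qed.

Lemma LambdaW_rectangle (W : m.+1.-tuple (nat * nat)) (g : nat -> seq nat) :
  (forall i, (i <= m)%N -> LambdaW S n beta W (g i)) ->
  exists2 t, LambdaW S n beta W t & forall i, (i <= m)%N ->
    block n m t i.+1 = block n m (g i) i.+1.
Proof.
move=> gW.
suff agree k : (k <= m)%N -> exists2 t, LambdaW S n beta W t &
    forall i, (i <= k)%N ->
    block n m t i.+1 = block n m (g i) i.+1.
  exact: agree.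
elim: k => [|k IH] km.
  by exists (g 0%N); [exact: gW | case].
have [t tW tE] := IH (ltnW km).
have [u uW uE] := LambdaW_crossover tW (gW _ km) km.
exists u => // i; rewrite leq_eqVlt => /orP[/eqP ->|ik].
  by rewrite uE // ltnn.
by rewrite uE ?(leq_trans (ltnW ik)) // ik tE.
Qed.

End Tau.

(** * Conditioning on [W] and the product formula *)

Lemma cond_uniform_prE (R : realType) (T : choiceType) (A E F : set T) :
  finite_set A -> A !=set0 -> F `<=` A ->
  cond_pr (uniform_pr R A) E F = uniform_pr R F E.
Proof.
move=> Afin [a Aa] FA; rewrite /cond_pr /uniform_pr.
have AF : A `&` F = F by apply/setIidPr.
rewrite [E `&` F]setIC setIA AF.
have A0 : #|` fset_set A|%:R != 0 :> R.
  rewrite pnatr_eq0 -lt0n cardfs_gt0; apply/fset0Pn; exists a.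
  by rewrite in_fset_set //; exact: mem_set.
by rewrite invf_div mulrA divfK.
Qed.

Theorem theorem9 (R : realType) (S : set nat) (n beta m : nat)
    (hS : proper_cofinite S)
    (hn : (0 < n)%N) (hbeta : (0 < beta)%N) (hm : (0 < m)%N)
    (hnm : (2 * beta < n %/ m)%N)
    (hLambda : Lambda S n beta !=set0)
    (W : m.+1.-tuple (nat * nat))
    (hW : LambdaW S n beta W !=set0)
    (y : 'I_m.+1 -> R) :
  cond_pr (Qn R S n beta)
    [set s | forall i : 'I_m.+1, Llog R n m s i.+1 = y i]
    (LambdaW S n beta W)
  = \prod_(i < m.+1)
      cond_pr (Qn R S n beta) [set s | Llog R n m s i.+1 = y i]
        (LambdaW S n beta W).
Proof.
have [Spos _ _] := hS.
have Lfin := @finite_Lambda S n beta Spos.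
have WL : LambdaW S n beta W `<=` Lambda S n beta by move=> s [].
have cE E : cond_pr (Qn R S n beta) E (LambdaW S n beta W)
    = uniform_pr R (LambdaW S n beta W) E by exact: cond_uniform_prE.
rewrite cE; under eq_bigr do rewrite cE.
(* Each [Llog] depends on its own block only, so the events are coordinatewise conditions on the
   block map. *)
apply: (@uniform_independent R m.+1 _ _ (LambdaW S n beta W)
  (fun i s => block n m s i.+1) (fun i b => ln ((Bprod b)%:R) = y i)) => //.
- exact: sub_finite_set WL Lfin.
- move=> s t Ws Wt st; apply: (LambdaW_blocks_inj hnm Ws Wt) => i im.
  exact: (st (Ordinal (im : i < m.+1)%N)).
- move=> g gW.
  (* [g] is indexed by ordinals; [inord] extends it to natural numbers. *)
  have [t tW tE] :=
    LambdaW_rectangle hnm (fun i (_ : (i <= m)%N) => gW (inord i)).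
  by exists t => // i; rewrite tE ?inord_val // -ltnS.
Qed.
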